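(* Let $(T,X)$ be a semiflow on a compact Hausdorff space $X$ with phase semigroup $T$. If $(T,X)$ is universally transitive, then $(T,X)$ is distal. If $(T,X)$ is point-transitive and universally transitive, then $(T,X)$ is minimal and distal.
   Context: A semiflow $(T,X)$ consists of a topological semigroup $T$ with neutral element $e$, a non-singleton topological space $X$, and a jointly continuous map $T\times X\to X$, $(t,x)\mapsto tx$, with $ex=x$ and $t(sx)=(ts)x$ for all $s,t\in T$, $x\in X$. $\mathrm{Aut}(T,X)$ is the group of all self-homeomorphisms $a$ of $X$ with $at=ta$ (as maps of $X$) for all $t\in T$. $(T,X)$ is universally transitive if $\mathrm{Aut}(T,X)x=X$ for some (equivalently, every) $x\in X$. $(T,X)$ is point-transitive if there is $x\in X$ whose orbit $Tx$ is dense in $X$. $(T,X)$ is minimal if $Tx$ is dense in $X$ for every $x\in X$. Let $\mathscr{U}_X$ be the compatible (symmetric) uniform structure of the compact Hausdorff space $X$. $(T,X)$ is distal if for all $x,y\in X$ with $x\neq y$ there is $\alpha\in\mathscr{U}_X$ such that $(tx,ty)\notin\alpha$ for all $t\in T$. *)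

(* Defs.v *)
From HB Require Import structures.
From mathcomp Require Import all_boot all_algebra all_classical.
From mathcomp Require Import topology.

Set Implicit Arguments.
Unset Strict Implicit.
Unset Printing Implicit Defensive.

Local Open Scope classical_set_scope.

HB.structure Definition PreTopologicalMonoid := {T of Topological T & Monoid T}.

HB.mixin Record PreTopologicalMonoid_isTopologicalMonoid T
    of PreTopologicalMonoid T := {
  mulg_continuous : continuous (fun p : T * T => (p.1 * p.2)%g)
}.

#[short(type="topologicalMonoidType")]
HB.structure Definition TopologicalMonoid :=
  {T of PreTopologicalMonoid T & PreTopologicalMonoid_isTopologicalMonoid T}.

Record semiflow (T : topologicalMonoidType) (X : topologicalType) := Semiflow {
  act :> T -> X -> X;
  act_continuous : continuous (fun p : T * X => act p.1 p.2);
  act1 : forall x, act 1%g x = x;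
  actM : forall t s x, act t (act s x) = act (t * s)%g x;
  semiflow_nonsingleton : exists x y : X, x <> y
}.

Definition homeomorphism (X Y : topologicalType) (a : X -> Y) : Prop :=
  continuous a /\
  exists b : Y -> X, [/\ continuous b, cancel a b & cancel b a].

Section Dynamics.
Context (T : topologicalMonoidType).

Section Topological.
Context (X : topologicalType) (phi : semiflow T X).

Definition Aut : set (X -> X) :=
  [set a | homeomorphism a /\ forall t, a \o phi t = phi t \o a].

Definition universally_transitive : Prop :=
  exists x : X, [set a x | a in Aut] = [set: X].

Definition orbit (x : X) : set X := [set phi t x | t in [set: T]].

Definition point_transitive : Prop := exists x : X, dense (orbit x).

Definition minimal : Prop := forall x : X, dense (orbit x).

End Topological.

(* A [uniformType] carries the topology induced by its entourages.  On a compact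
   Hausdorff space this uniformity is the unique compatible one; such a space
   gets it from [completely_regular_uniformity.type]. *)
Definition distal (X : uniformType) (phi : semiflow T X) : Prop :=
  forall x y : X, x <> y ->
    exists alpha : set (X * X),
      [/\ entourage alpha, (alpha^-1)%relation = alpha
        & forall t : T, ~ alpha (phi t x, phi t y)].

End Dynamics.

(* Main.v *)
Require Import Defs.
From mathcomp Require Import all_boot all_algebra all_classical.
From mathcomp Require Import topology.

Set Implicit Arguments.
Unset Strict Implicit.

(** Write [A] for the automorphism group, assumed transitive on the compact
    Hausdorff space [X].  The maps [X -> X] (continuous or not) that commute
    with every element of [A] form a closed subsemigroup [C] of the compact
    space [X ^ X] of pointwise convergence, and [C] contains the translations
    by [T].

    An idempotent [u] of [C] is the identity: given [x], some [a] in [A] maps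
    [u x] to [x], whence [u x = u (a (u x)) = a (u (u x)) = a (u x) = x].  For
    [p] in [C], the set [C p] is a compact semigroup on which right
    translations are continuous, so by the Ellis-Numakura theorem it contains
    an idempotent, which must be the identity.  Thus [p] has a left inverse:
    every element of [C] is injective ([equivariant_inj]).

    If distality failed at [x <> y], compactness of [C] would yield a limit
    [p] in [C] of translations bringing [x] and [y] arbitrarily close, hence
    [p x = p y], which is impossible.  Minimality is simpler: automorphisms map
    dense orbits to dense orbits, and they reach every point. *)

Local Open Scope classical_set_scope.

Lemma closed_equalizer (S Y : topologicalType) (f g : S -> Y) :
  hausdorff_space Y -> continuous f -> continuous g ->
  closed [set x | f x = g x].
Proof.
move=> hY cf cg x clx; apply: hY => A B Afx Bgx.
have fA : nbhs x (f @^-1` A) by exact: cf.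
have gB : nbhs x (g @^-1` B) by exact: cg.
have [z [fgz [Az Bz]]] := clx _ (filterI fA gB).
by exists (f z); split=> //; rewrite fgz.
Qed.

(** * Idempotents in compact right topological semigroups *)

Section EllisNumakura.
Context (S : topologicalType) (op : S -> S -> S).
Hypothesis S_hausdorff : hausdorff_space S.
Hypothesis opA : associative op.
Hypothesis op_continuous : forall s, continuous (op^~ s).

Definition op_closed (A : set S) : Prop :=
  forall x y, A x -> A y -> A (op x y).

Definition closed_subsemigroup (A : set S) : Prop :=
  [/\ closed A, A !=set0 & op_closed A].

(** Zorn's lemma is applied to the complements: these are open, and
    compactness of [K] keeps the union of a chain of them from covering [K]. *)
Lemma minimal_closed_subsemigroup (K : set S) :
  compact K -> K !=set0 -> op_closed K ->
  exists A, [/\ A `<=` K, closed_subsemigroup A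
    & forall B, B `<=` A -> closed_subsemigroup B -> B = A].
Proof.
move=> cK K0 KM; have clK := compact_closed S_hausdorff cK.
pose P : set (set S) := [set U | open U /\ closed_subsemigroup (K `\` U)].
have [|U [[oU sgU] maxU]] := @Zorn_bigcup S P.
  move=> F FP Ftot; have oF : open (\bigcup_(U in F) U).
    by apply: bigcup_open => U /FP[].
  split=> //; split; first by apply: closedI => //; exact: open_closedC.
  - have [[U0 FU0]|F0] := pselect (F !=set0); last first.
      by have [k Kk] := K0; exists k; split=> // -[U FU]; case: F0; exists U.
    pose FF := filter_from F (fun U => K `\` U).
    have PF : ProperFilter FF.
      apply: filter_from_proper; last by move=> U /FP[_ []].
      apply: filter_from_filter; first by exists U0.
      move=> U V FU FV; have [UV|VU] := Ftot _ _ FU FV.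
        by exists V => // x [Kx Vx]; split; split=> // /UV.
      by exists U => // x [Kx Ux]; split; split=> // /VU.
    have FFK : FF K by exists U0 => // x [].
    have [k [Kk clk]] := cK _ PF FFK; exists k; split=> // -[U FU Uk].
    have FFU : FF (K `\` U) by exists U.
    have Unbhs : nbhs k U by apply: open_nbhs_nbhs; split=> //; case: (FP _ FU).
    by have [z [[_ nUz] Uz]] := clk _ _ FFU Unbhs.
  - move=> x y [Kx nx] [Ky ny]; split; first exact: KM.
    move=> [U FU Uxy]; have [_ [_ _ UM]] := FP _ FU.
    have KUx : (K `\` U) x by split=> // Ux; apply: nx; exists U.
    have KUy : (K `\` U) y by split=> // Uy; apply: ny; exists U.
    by case: (UM _ _ KUx KUy).
exists (K `\` U); split=> // B BKU [clB B0 BM].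
have KB : K `\` ~` B = B.
  by rewrite setDE setCK; apply/setIidPr => x /BKU[].
(* the competitor [~` B] contains [U] because [B] avoids it *)
have PB : P (~` B) by split; [exact: closed_openC|rewrite KB].
have UB : U `<=` ~` B by move=> x Ux /BKU[].
have [BU|nBU] := pselect (~` B `<=` U).
  by rewrite -{1}KB; congr (_ `\` _); apply/seteqP.
by case: (maxU _ _ PB); split.
Qed.

(** Let [s] be in a minimal closed subsemigroup [A].  The left ideal [A s] is
    a closed subsemigroup, so it is all of [A] and some [x] in [A] satisfies
    [x s = s].  Hence the elements of [A] that fix [s] form a nonempty closed
    subsemigroup, which is again all of [A]; in particular [s s = s]. *)
Theorem ellis_numakura (K : set S) :
  compact K -> K !=set0 -> op_closed K -> exists2 u, K u & op u u = u.
Proof.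
move=> cK K0 KM.
have [A [AK [clA [s As] AM] minA]] := minimal_closed_subsemigroup cK K0 KM.
have cA : compact A by exact: subclosed_compact clA cK AK.
have AsE : [set op x s | x in A] = A.
  apply: minA => [_ [x Ax <-]|]; first exact: AM.
  split.
  - apply: compact_closed => //; apply: continuous_compact => //.
    exact/continuous_subspaceT.
  - by exists (op s s), s.
  - move=> _ _ [x Ax <-] [y Ay <-]; exists (op (op x s) y); last by rewrite opA.
    exact: AM _ _ (AM _ _ Ax As) Ay.
have stabE : A `&` [set x | op x s = s] = A.
  apply: minA => [x []//|]; split.
  - by apply: closedI => //; apply: closed_equalizer => // x; exact: cvg_cst.
  - by move: As; rewrite -{1}AsE => -[x Ax xs]; exists x.
  - move=> x y [Ax xs] [Ay ys]; split; first exact: AM.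
    by rewrite /= -opA ys xs.
exists s; first exact: AK.
by move: As; rewrite -stabE => -[].
Qed.

End EllisNumakura.

(** * Maps commuting with a transitive family *)

Section Equivariant.
Context (X : uniformType).
Hypothesis X_compact : compact [set: X].
Hypothesis X_hausdorff : hausdorff_space X.
Context (G : set (X -> X)).
Hypothesis G_continuous : forall a, G a -> continuous a.

Definition equivariant : set {ptws X -> X} :=
  [set f | forall a, G a -> forall x, f (a x) = a (f x)].

Lemma eval_continuous (x : X) : continuous (fun f : {ptws X -> X} => f x).
Proof. exact: (@proj_continuous X (fun=> X) x). Qed.

Lemma precomp_continuous (s : X -> X) :
  continuous (fun f : {ptws X -> X} => (f \o s : {ptws X -> X})).
Proof.
move=> f; have FF : Filter (nbhs (f : {ptws X -> X})) by exact: nbhs_filter.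
apply/(@pointwise_cvgP X X _ (f \o s) (fmap_filter _ FF)) => x.
exact: (@eval_continuous (s x) f).
Qed.

Lemma ptws_hausdorff : hausdorff_space {ptws X -> X}.
Proof. exact: (@hausdorff_product X (fun=> X)). Qed.

Lemma equivariant_compact : compact equivariant.
Proof.
have cXX : compact [set: {ptws X -> X}].
  have := @tychonoff X (fun=> X) (fun=> setT) (fun=> X_compact).
  by congr (compact _); apply/seteqP; split.
apply: (subclosed_compact _ cXX) => //.
have -> : equivariant =
    \bigcap_(a in G) \bigcap_x [set f : {ptws X -> X} | f (a x) = a (f x)].
  by apply/seteqP; split=> f Ef a Ga x; [move=> _|]; exact: Ef.
apply: closed_bigI => a Ga; apply: closed_bigI => x _.
apply: closed_equalizer => //; first exact: eval_continuous.
move=> f; apply: (@continuous_comp _ _ _ (fun g : {ptws X -> X} => g x) a).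
  exact: eval_continuous.
exact: G_continuous.
Qed.

Hypothesis G_transitive : forall x y, exists2 a, G a & a x = y.

Lemma equivariant_idempotent (u : X -> X) :
  equivariant u -> u \o u = u -> u =1 id.
Proof.
move=> Eu uu x; have [a Ga ax] := G_transitive (u x) x.
by rewrite -{1}ax Eu// -[u (u x)]/((u \o u) x) uu.
Qed.

(** The left inverse of [p] is the identity found as an idempotent of the
    compact semigroup formed by the [q \o p] with [q] equivariant. *)
Lemma equivariant_inj (p : X -> X) : equivariant p -> injective p.
Proof.
move=> Ep.
have EM f g : equivariant f -> equivariant g -> equivariant (f \o g).
  by move=> Ef Eg a Ga x; rewrite /= Eg// Ef.
pose K : set {ptws X -> X} := [set (q \o p : {ptws X -> X}) | q in equivariant].
have cK : compact K.
  apply: continuous_compact equivariant_compact.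
  by apply: continuous_subspaceT; exact: precomp_continuous.
have K0 : K !=set0 by exists (p \o p), p.
have [||_ [q Eq <-] idem] := @ellis_numakura {ptws X -> X} (fun f g => f \o g)
    ptws_hausdorff _ precomp_continuous K cK K0.
- by [].
- move=> _ _ [f Ef <-] [g Eg <-]; exists (f \o p \o g) => //.
  exact: EM (EM _ _ Ef Ep) Eg.
apply: (can_inj (g := q)) => x.
exact: (equivariant_idempotent (EM _ _ Eq Ep) idem x).
Qed.

(** Equivariant maps that bring [x] and [y] arbitrarily close accumulate at an
    equivariant map identifying them. *)
Lemma equivariant_separated (F : set (X -> X)) (x y : X) :
  F `<=` equivariant ->
  (forall A : set (X * X), entourage A -> exists2 f, F f & A (f x, f y)) ->
  x = y.
Proof.
move=> FE prox.
pose B (A : set (X * X)) : set {ptws X -> X} :=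
  equivariant `&` [set f | A (f x, f y)].
have BF : ProperFilter (filter_from entourage B).
  apply: filter_from_proper => [|A /prox[f Ff Af]]; last first.
    by exists f; split=> //; exact: FE.
  apply: filter_from_filter; first by exists setT; exact: filterT.
  move=> A1 A2 e1 e2; exists (A1 `&` A2); first exact: filterI.
  by move=> f [Ef [A1f A2f]]; split; split.
have [|p [Ep clp]] := equivariant_compact BF.
  by exists setT; [exact: filterT|move=> f []].
apply: (equivariant_inj Ep); apply: close_eq => //; rewrite entourage_close.
move=> A eA.
(* [p x], [f x], [f y], [p y] are successively close: three steps in
   [split_ent (split_ent A)], for a suitable [f] *)
have eA1 : entourage (split_ent A) by exact: entourage_split_ent.
pose D := split_ent (split_ent A).
have eD : entourage D by exact: entourage_split_ent.
have nx : nbhs (p : {ptws X -> X}) [set f : {ptws X -> X} | D (p x, f x)].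
  apply: (@eval_continuous x p [set z | D (p x, z)]).
  by apply: filterS (nbhs_entourage (p x) eD) => z /xsectionP.
have ny : nbhs (p : {ptws X -> X}) [set f : {ptws X -> X} | D (f y, p y)].
  apply: (@eval_continuous y p [set z | D (z, p y)]).
  apply: filterS (nbhs_entourage (p y) (entourage_inv eD)) => z.
  by move/xsectionP.
have BD : filter_from entourage B (B D) by exists D.
have [f [[_ Df] [pfx fpy]]] := clp _ _ BD (filterI nx ny).
apply: (entourage_split (f x) eA).
  exact: split_ent_subset eA1 _ pfx.
exact: (entourage_split (f y) eA1).
Qed.

End Equivariant.

(** * Universally transitive semiflows *)

Section UniversallyTransitive.
Context (T : topologicalMonoidType).

Lemma Aut_transitive (X : topologicalType) (phi : semiflow T X) :
  universally_transitive phi ->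
  forall x y, exists2 a, Aut phi a & a x = y.
Proof.
move=> [z Gz] x y.
have [a [[ca [a' [ca' aK a'K]]] aT] ax] : [set a z | a in Aut phi] x.
  by rewrite Gz.
have [b [[cb [b' [cb' bK b'K]]] bT] bx] : [set a z | a in Aut phi] y.
  by rewrite Gz.
exists (b \o a'); last by rewrite /= -ax aK.
split.
  split; first by move=> w; apply: continuous_comp; [exact: ca'|exact: cb].
  exists (a \o b'); split.
  - by move=> w; apply: continuous_comp; [exact: cb'|exact: ca].
  - by move=> w /=; rewrite bK a'K.
  - by move=> w /=; rewrite aK b'K.
have a'T t w : a' (phi t w) = phi t (a' w).
  by rewrite -{1}(a'K w) -[phi t (a _)]/((phi t \o a) _) -aT /= aK.
move=> t; apply/funext => w /=; rewrite a'T.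
by rewrite -[b _]/((b \o phi t) _) bT.
Qed.

Lemma universally_transitive_distal (X : uniformType) (phi : semiflow T X) :
  compact [set: X] -> hausdorff_space X ->
  universally_transitive phi -> distal phi.
Proof.
move=> cX hX /Aut_transitive Gtr x y xy; apply: contrapT => ndist; apply: xy.
apply: (equivariant_separated cX hX _ Gtr (F := range phi)).
- by move=> a [[]].
- by move=> _ [t _ <-] a [_ aT] z; rewrite -[RHS]/((a \o phi t) z) aT.
move=> A eA; apply: contrapT => nA; apply: ndist.
exists (A `&` A^-1)%relation; split.
- exact: entourage_invI.
- by apply/seteqP; split=> -[u v] [].
- by move=> t [At _]; apply: nA; exists (phi t).
Qed.

Lemma dense_orbit_Aut (X : topologicalType) (phi : semiflow T X) a x :
  Aut phi a -> dense (Defs.orbit phi x) -> dense (Defs.orbit phi (a x)).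
Proof.
move=> [[ca [b [_ _ bK]]] aT] dx U [u Uu] oU.
have [|z [Uz [t _ tx]]] := dx (a @^-1` U) _ (open_comp (in1W ca) oU).
  by exists (b u); rewrite /= bK.
exists (a z); split=> //; exists t => //.
by rewrite -tx -[LHS]/((phi t \o a) x) -aT.
Qed.

End UniversallyTransitive.

Theorem theorem4p16 (T : topologicalMonoidType) (X : uniformType)
    (X_compact : compact [set: X]) (X_hausdorff : hausdorff_space X)
    (phi : semiflow T X) :
  (universally_transitive phi -> distal phi) /\
  (point_transitive phi -> universally_transitive phi ->
    minimal phi /\ distal phi).
Proof.
have dist := universally_transitive_distal X_compact X_hausdorff (phi := phi).
split=> // -[x dx] ut; split; last exact: dist.
move=> y; have [a aA <-] := Aut_transitive ut x y.
exact: dense_orbit_Aut.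
Qed.
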